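(* Let $T$ be a tree on $n$ vertices and let $k\ge 2$ be a natural number. Then $$SW_k(T)=\sum_{v\in V(T)} N_k(T-v)+(k-1)\binom{n}{k}.$$
   Context: All graphs are finite, simple and undirected; $n(G)$ denotes the number of vertices of a graph $G$. For a connected graph $G$ and $S\subseteq V(G)$, the Steiner diversity $\delta(S)$ is the minimum number of edges of a connected subgraph of $G$ whose vertex set contains $S$. For a natural number $k\ge 2$ the Steiner $k$-Wiener index of $G$ is $SW_k(G)=\sum_{S\subseteq V(G),\,|S|=k}\delta(S)$. For a tree $T$ and $v\in V(T)$, $T-v$ denotes the graph obtained by removing the vertex $v$ (and all edges incident with it) from $T$; it is a forest whose number of connected components equals the degree of $v$. For a forest (acyclic graph) $F$ with $p>1$ connected components $T_1,\ldots,T_p$, define $$N_k(F)=\sum_{\substack{l_1+l_2+\cdots+l_p=k\\ 0\le l_1,\ldots,l_p<k}}\binom{n(T_1)}{l_1}\binom{n(T_2)}{l_2}\cdots\binom{n(T_p)}{l_p},$$ where the sum is over tuples of integers $(l_1,\ldots,l_p)$, $\binom{m}{0}=1$ and $\binom{m}{l}=0$ whenever $m<l$. For a tree $T$ (a forest with one component), $N_k(T)=0$; for the empty graph (which arises only when $n=1$), $N_k=0$. *)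

(* Defs.v *)
From mathcomp Require Import all_boot.

Set Implicit Arguments.
Unset Strict Implicit.
Unset Printing Implicit Defensive.

(* Finite simple undirected graphs. *)
Record sgraph := SGraph {
  vertex :> finType;
  adj : rel vertex;
  adj_sym : symmetric adj;
  adj_irr : irreflexive adj
}.

Definition edges (G : sgraph) : {set {set G}} :=
  [set [set p.1; p.2] | p : G * G & adj p.1 p.2].

(* The null graph is not connected. When [r] is the adjacency of a subgraph
   with vertex set [W], every [r]-path of positive length stays in [W]. *)
Definition connected_on (V : finType) (W : {set V}) (r : rel V) : bool :=
  (W != set0) && [forall x in W, forall y in W, connect r x y].

Definition connected (G : sgraph) : bool := connected_on [set: G] (@adj G).

(* In a simple graph, cycles have length at least 3; [ucycle (@adj G) [:: x; y]]
   also holds whenever x and y are adjacent. *)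
Definition acyclic (G : sgraph) : Prop :=
  forall c : seq G, 2 < size c -> ~ ucycle (@adj G) c.

Definition is_tree (G : sgraph) : Prop := connected G /\ acyclic G.

(* [H.1] is the vertex set and [H.2] the edge set. *)
Definition is_subgraph (G : sgraph) (H : {set G} * {set {set G}}) : bool :=
  (H.2 \subset edges G) && [forall e in H.2, e \subset H.1].

Definition connected_subgraph (G : sgraph) (H : {set G} * {set {set G}}) :
    bool :=
  is_subgraph H && connected_on H.1 [rel x y | [set x; y] \in H.2].

(* If [G] is connected, [G] itself is among the subgraphs [H], so the default
   value [#|edges G|] does not affect the minimum. *)
Definition steiner_diversity (G : sgraph) (S : {set G}) : nat :=
  \big[minn/#|edges G|]_(H : {set G} * {set {set G}} |
      connected_subgraph H && (S \subset H.1)) #|H.2|.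

Definition steiner_wiener (k : nat) (G : sgraph) : nat :=
  \sum_(S : {set G} | #|S| == k) steiner_diversity S.

Section DeleteVertex.
Variables (G : sgraph) (v : G).

Definition del_adj : rel {x : G | x != v} := [rel x y | adj (val x) (val y)].

Lemma del_adj_sym : symmetric del_adj.
Proof. by move=> x y; apply: adj_sym. Qed.

Lemma del_adj_irr : irreflexive del_adj.
Proof. by move=> x; apply: adj_irr. Qed.

Definition del_vertex : sgraph := SGraph del_adj_sym del_adj_irr.

End DeleteVertex.

(* The vertex sets of the connected components. *)
Definition components (G : sgraph) : {set {set G}} :=
  equivalence_partition (connect (@adj G)) [set: G].

(* [l i] ranges over ['I_k], which encodes 0 <= l_i < k, and the enumeration
   [enum_val] lists the components T_1, ..., T_p. *)
Definition Nk (k : nat) (F : sgraph) : nat :=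
  let p := #|components F| in
  if 1 < p then
    \sum_(l : {ffun 'I_p -> 'I_k} | \sum_(i < p) l i == k)
      \prod_(i < p) 'C(#|(enum_val i : {set F})|, l i)
  else 0.

(* Main.v *)
Require Import Defs.
From mathcomp Require Import all_boot zify.

Set Implicit Arguments.
Unset Strict Implicit.
Unset Printing Implicit Defensive.

(** Fix a tree and a nonempty set [S] of [k] vertices. Say that a vertex [v]
separates [S] if [v] is not in [S] and [S] meets at least two components of the
tree without [v], and let the hull of [S] consist of [S] and of the vertices
that separate it.

A connected subgraph containing [S] contains the hull: if it misses a vertex
[v], it stays in one component of the tree without [v]
([separates_mem_connected_subgraph]). The hull itself induces a connected
subgraph ([connected_steiner_hull]): an inner vertex of a simple path between
two elements of [S] is either in [S] or separates [S]
([uniq_path_separates]), since otherwise two of its neighbours would be joined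
by a path avoiding it, which closes a cycle; and every separating vertex is on
such a path. As every connected subgraph has a spanning subgraph that is still
connected and has one edge less than vertices ([spanning_tree]), the Steiner
diversity of [S] is the size of the hull minus one ([steiner_diversityE]), that
is, [k - 1] plus the number of vertices that separate [S].

Summing over all [S] gives the term [(k - 1) * 'C(n, k)] and, for each vertex
[v], the number of [k]-sets separated by [v]. Those are the [k]-subsets of the
tree without [v] not contained in one component. Sorting them by the sizes of
their intersections with the components ([sum_block_profiles]) shows that their
number is [Nk k (del_vertex v)] ([Nk_del_vertex]). *)

(** * Adjacency and edges *)

Lemma bigminn_leq (I : finType) (P : pred I) (f : I -> nat) m (j : I) :
  P j -> \big[minn/m]_(i | P i) f i <= f j.
Proof.
move=> Pj; have : j \in index_enum I by rewrite mem_index_enum.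
elim: (index_enum I) => //= i r IHr; rewrite inE big_cons => /predU1P[<-|/IHr le].
  by rewrite Pj geq_minl.
by case: ifP => // _; rewrite geq_min le orbT.
Qed.

Lemma in_edges (G : sgraph) (x y : G) : ([set x; y] \in edges G) = adj x y.
Proof.
apply/imsetP/idP => [[[a b] ab /setP e] | xy]; last by exists (x, y); rewrite ?inE.
rewrite inE /= in ab.
have neq : a != b by apply: contraTneq ab => ->; rewrite adj_irr.
move: (e x) (e y) (e a) (e b); rewrite !inE !eqxx /= !orbT.
case/esym/orP => /eqP-> ; case/esym/orP=> /eqP->.
- by rewrite orbb (eq_sym b) (negbTE neq).
- by [].
- by rewrite adj_sym.
- by rewrite orbb (negbTE neq).
Qed.

Lemma connect_adj_sym (G : sgraph) : connect_sym (@adj G).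
Proof. exact/sym_connect_sym/adj_sym. Qed.

(** * Spanning trees of connected subgraphs *)

Section Subgraphs.
Variable G : sgraph.
Implicit Types (U W S : {set G}) (E F : {set {set G}}).

(** The adjacency relation of the graph with edge set [E]. *)
Definition edge_rel E : rel G := [rel x y | [set x; y] \in E].

Lemma connect_edge_rel_sym E : connect_sym (edge_rel E).
Proof. by apply: sym_connect_sym => x y; rewrite /edge_rel /= setUC. Qed.

Lemma connected_subgraphP W E :
  reflect [/\ E \subset edges G, {in E, forall e : {set G}, e \subset W}, W != set0
            & {in W &, forall x y, connect (edge_rel E) x y}]
          (connected_subgraph (W, E)).
Proof.
rewrite /connected_subgraph /is_subgraph /connected_on /=.
apply: (iffP idP).
  case/andP=> /andP[sE /forall_inP sW] /andP[W0 /forall_inP cW]; split=> //.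
  by move=> x y xW yW; move/forall_inP: (cW x xW); apply.
case=> -> sW -> cW /=.
apply/andP; split; apply/forall_inP => // x xW.
by apply/forall_inP=> y yW; apply: cW.
Qed.

(** A connected subgraph has an edge leaving each proper nonempty part of its
vertex set. *)
Lemma connected_subgraph_cut W E U x y :
  connected_subgraph (W, E) -> x \in U -> y \in W -> y \notin U -> x \in W ->
  exists u w, [/\ u \in U, w \in W, w \notin U & [set u; w] \in E].
Proof.
case/connected_subgraphP=> _ sW _ cW xU yW yU xW.
have [/existsP[u /existsP[w /and3P[uU wU uw]]]|no] :=
  boolP [exists u, exists w, [&& u \in U, w \notin U & [set u; w] \in E]].
  by exists u, w; split=> //; apply: (subsetP (sW _ uw)); rewrite set22.
have cl : closed (edge_rel E) (mem U).
  apply: (intro_closed (@connect_edge_rel_sym E)) => a b /= ab aU.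
  apply: contraNT no => bU; apply/existsP; exists a; apply/existsP; exists b.
  by apply/and3P.
by move: (closed_connect cl (cW x y xW yW)); rewrite /= xU (negbTE yU).
Qed.

(** Grow a tree inside a connected subgraph, adding one vertex and one edge at
a time. *)
Lemma connected_subgraph_grow W E m :
  connected_subgraph (W, E) -> m < #|W| ->
  exists U F, [/\ U \subset W, F \subset E, connected_subgraph (U, F),
                  #|U| = m.+1 & #|F| = m].
Proof.
move=> cWE; case/connected_subgraphP: (cWE) => sE sW W0 _.
elim: m => [_|m IHm ltm].
  case/set0Pn: W0 => x xW; exists [set x], set0.
  rewrite sub1set sub0set cards1 cards0; split=> //.
  apply/connected_subgraphP; split; first exact: sub0set.
  - by move=> e; rewrite inE.
  - by apply/set0Pn; exists x; rewrite set11.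
  - by move=> a b /set1P-> /set1P->; apply: connect0.
have [U [F [sUW sFE cUF cardU cardF]]] := IHm (ltnW ltm).
case/connected_subgraphP: (cUF) => sF sU U0 cU.
have [y yW yU] : exists2 y, y \in W & y \notin U.
  apply/subsetPn; apply: contraL ltm => /subset_leq_card.
  by rewrite cardU -leqNgt.
have [x xU] := set0Pn _ U0.
have [u [w [uU wW wU uw]]] :=
  connected_subgraph_cut cWE xU yW yU (subsetP sUW x xU).
have uwF : [set u; w] \notin F.
  by apply: contra wU => /sU /subsetP; apply; rewrite set22.
exists (w |: U), ([set u; w] |: F).
rewrite !cardsU1 wU uwF cardU cardF; split=> //.
- by rewrite subUset sub1set wW.
- by rewrite subUset sub1set uw.
apply/connected_subgraphP; split.
- by rewrite subUset sub1set (subsetP sE).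
- move=> e /setU1P[->|/sU eU]; last exact: subset_trans eU (subsetUr _ _).
  by rewrite subUset !sub1set !inE eqxx uU orbT.
- by apply/set0Pn; exists w; rewrite setU11.
have cu a : a \in w |: U -> connect (edge_rel ([set u; w] |: F)) u a.
  case/setU1P=> [->|aU]; first by apply: connect1; rewrite /edge_rel /= setU11.
  apply: connect_sub (cU _ _ uU aU) => b c /= bc.
  by apply: connect1; rewrite /edge_rel /= setU1r.
by move=> a b /cu ua /cu ub; apply: connect_trans ub; rewrite connect_edge_rel_sym.
Qed.

Lemma spanning_tree W E :
  connected_subgraph (W, E) ->
  exists F, [/\ F \subset E, connected_subgraph (W, F) & #|F|.+1 = #|W|].
Proof.
move=> cWE; have [_ _ W0 _] := connected_subgraphP _ _ cWE.
have lt : #|W|.-1 < #|W| by rewrite prednK // card_gt0.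
have [U [F [sUW sFE cUF cardU cardF]]] := connected_subgraph_grow cWE lt.
have eW : U = W by apply/eqP; rewrite eqEcard sUW cardU leqSpred.
by exists F; rewrite -eW cardU cardF; split.
Qed.

Lemma leq_card_edges W E : connected_subgraph (W, E) -> #|W| <= #|E|.+1.
Proof. by case/spanning_tree => F [/subset_leq_card ? _ <-]. Qed.

(** The edge set of the subgraph of [G] induced by [W]. *)
Definition induced_edges W : {set {set G}} :=
  [set e in edges G | e \subset W].

Lemma edge_rel_induced W x y :
  edge_rel (induced_edges W) x y = [&& adj x y, x \in W & y \in W].
Proof. by rewrite /edge_rel /= inE in_edges subUset !sub1set. Qed.

Lemma connected_subgraph_induced W :
  W != set0 ->
  {in W &, forall x y, connect (edge_rel (induced_edges W)) x y} ->
  connected_subgraph (W, induced_edges W).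
Proof.
move=> W0 cW; apply/connected_subgraphP; split=> //.
  by apply/subsetP=> e; rewrite inE => /andP[].
by move=> e; rewrite inE => /andP[].
Qed.

End Subgraphs.

(** * Vertices that separate a set *)

Section DeletedVertex.
Variables (G : sgraph) (v : G).

(** [path_del_connect] and [del_connect_path] identify connection in
[del_vertex v] with the existence of a path of [G] that avoids [v]. *)
Lemma path_del_connect (a b : del_vertex v) p :
  path (@adj G) (val a) p -> v \notin p -> last (val a) p = val b ->
  connect (@adj (del_vertex v)) a b.
Proof.
elim: p a => [|c p IHp] a /=.
  by move=> _ _ /val_inj->.
case/andP=> ac cp; rewrite inE negb_or => /andP[vc vp] lst.
have cv : c != v by rewrite eq_sym.
apply: (@connect_trans _ _ (Sub c cv : del_vertex v)); first exact: connect1.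
exact: IHp.
Qed.

Lemma del_connect_path (a b : del_vertex v) :
  connect (@adj (del_vertex v)) a b ->
  exists p, [/\ path (@adj G) (val a) p, last (val a) p = val b,
                uniq (val a :: p) & v \notin val a :: p].
Proof.
case/connectP=> p ap ->; case/shortenP: ap => q aq uq _.
exists (map val q); split.
- by elim: q a {uq} aq => //= c q IHq a /andP[ac /IHq->]; rewrite andbT.
- by rewrite last_map.
- by rewrite -map_cons map_inj_uniq //; apply: val_inj.
by rewrite -map_cons; apply/mapP=> -[[c cv] _ /= e]; rewrite e eqxx in cv.
Qed.

(** [v] is not in [S], and [S] meets at least two components of
[del_vertex v]. *)
Definition separates (S : {set G}) : bool :=
  (v \notin S) &&
  [exists a : del_vertex v, exists b : del_vertex v,
    [&& val a \in S, val b \in S & ~~ connect (@adj (del_vertex v)) a b]].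

(** A path that avoids [v] between two distinct neighbours of [v] would close
a cycle through [v]. *)
Lemma acyclic_neighbours_disconnected (a b : del_vertex v) :
  acyclic G -> adj v (val a) -> adj v (val b) -> a != b ->
  ~~ connect (@adj (del_vertex v)) a b.
Proof.
move=> acG va vb ab; apply/negP => /del_connect_path[p [ap lst up vp]].
have p0 : 0 < size p.
  by case: (p) lst ab => //= /val_inj->; rewrite eqxx.
apply: (acG [:: v, val a & p]) => //.
apply/andP; split; last by rewrite cons_uniq vp.
have -> : cycle (@adj G) [:: v, val a & p] =
          path (@adj G) v (val a :: p) && adj (last v (val a :: p)) v.
  by rewrite -rcons_path.
by rewrite /= va ap lst adj_sym.
Qed.

(** The predecessor and the successor of [v] on the path are in different
components of [del_vertex v], and each is connected to the endpoint on its
side. *)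
Lemma uniq_path_separates (S : {set G}) x p :
  acyclic G -> path (@adj G) x p -> uniq (x :: p) -> x \in S ->
  last x p \in S -> v \in p -> v \notin S -> separates S.
Proof.
move=> acG xp up xS lS vp vS; apply/andP; split=> //.
case/splitPr: vp => p1 p2 in xp up lS.
rewrite last_cat /= in lS; rewrite cat_path /= in xp.
case/andP: xp => xp1 lv.
case: p2 => [|b p2] /= in up lv lS *; first by rewrite (negbTE vS) in lS.
case/and3P: lv => lv vb bp2.
move: up; rewrite -/(uniq (x :: p1 ++ _)) -cat_cons cat_uniq.
case/and3P=> _ /hasPn dis; rewrite cons_uniq => /andP[vbp2 _].
have vxp1 : v \notin x :: p1 by apply: dis; rewrite mem_head.
have bxp1 : b \notin x :: p1 by apply: dis; rewrite !inE eqxx orbT.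
have xv : x != v by apply: contraNneq vxp1 => ->; rewrite mem_head.
have av : last x p1 != v by apply: contraNneq vxp1 => <-; rewrite mem_last.
have bv : b != v by apply: contraNneq vbp2 => ->; rewrite mem_head.
have yv : last b p2 != v by apply: contraTneq lS => ->.
pose x' : del_vertex v := exist _ x xv.
pose a' : del_vertex v := exist _ (last x p1) av.
pose b' : del_vertex v := exist _ b bv.
pose y' : del_vertex v := exist _ (last b p2) yv.
have ax : connect (@adj (del_vertex v)) a' x'.
  rewrite connect_adj_sym.
  apply: (@path_del_connect _ _ p1) => //.
  by apply: contra vxp1; rewrite inE orbC => ->.
have yb : connect (@adj (del_vertex v)) y' b'.
  rewrite connect_adj_sym.
  apply: (@path_del_connect _ _ p2) => //.
  by apply: contra vbp2; rewrite inE orbC => ->.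
have ab : ~~ connect (@adj (del_vertex v)) a' b'.
  apply: acyclic_neighbours_disconnected => //; first by rewrite adj_sym.
  by rewrite -val_eqE; apply: contraNneq bxp1 => /= <-; rewrite mem_last.
apply/existsP; exists x'; apply/existsP; exists y'; rewrite xS lS /=.
apply: contra ab => xy.
exact: connect_trans ax (connect_trans xy yb).
Qed.

(** A connected subgraph that avoids [v] lies in one component of
[del_vertex v]. *)
Lemma separates_mem_connected_subgraph (S W : {set G}) E :
  connected_subgraph (W, E) -> S \subset W -> separates S -> v \in W.
Proof.
case/connected_subgraphP=> sE sW _ cW /subsetP sSW.
case/andP=> _ /existsP[a /existsP[b /and3P[aS bS]]].
apply: contraNT => vW.
have /connectP[p ap lst] := cW _ _ (sSW _ aS) (sSW _ bS).
have pW : v \notin p.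
  elim: p {lst} (val a) ap => //= c p IHp x /andP[xc cp].
  rewrite inE negb_or (IHp c cp) andbT.
  by apply: contraNneq vW => ->; apply: (subsetP (sW _ xc)); rewrite set22.
apply: (path_del_connect _ pW) => //.
by apply: sub_path ap => x y xy; rewrite -in_edges (subsetP sE).
Qed.

End DeletedVertex.

(** * Steiner diversity in a tree *)

Section Steiner.
Variable G : sgraph.
Implicit Types (S W : {set G}).

(** In a tree, and for nonempty [S], the vertex set of the smallest subtree
containing [S]. *)
Definition steiner_hull S : {set G} := S :|: [set v | separates v S].

Lemma card_steiner_hull S :
  #|steiner_hull S| = #|S| + \sum_(v : G) separates v S.
Proof.
rewrite cardsU disjoint_setI0 ?cards0 ?subn0.
  congr (_ + _); rewrite -sum1_card [RHS]big_mkcond [LHS]big_mkcond.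
  by apply: eq_bigr => v _; rewrite inE; case: separates.
apply/pred0P => v /=; rewrite inE /separates andbCA.
by case: (v \in S).
Qed.

Lemma connected_subgraph_total :
  connected G -> connected_subgraph ([set: G], edges G).
Proof.
case/andP=> G0 /forall_inP cG; apply/connected_subgraphP; split=> // x y xG yG.
have := forall_inP (cG x xG) y yG; congr is_true.
by apply: eq_connect => a b; rewrite /edge_rel /= in_edges.
Qed.

Lemma connected_steiner_hull S :
  is_tree G -> S != set0 ->
  connected_subgraph (steiner_hull S, induced_edges (steiner_hull S)).
Proof.
case=> cG acG S0; set W := steiner_hull S.
have sSW : {subset S <= W} by apply/subsetP/subsetUl.
have upath x y : exists p,
  [/\ path (@adj G) x p, last x p = y & uniq (x :: p)].
  case/andP: cG => _ /forall_inP /(_ x (in_setT _)) /forall_inP.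
  case/(_ y (in_setT _))/connectP => p xp ->.
  by case/shortenP: xp => q xq uq _; exists q.
have hullp x p : path (@adj G) x p -> uniq (x :: p) -> x \in S ->
    last x p \in S -> {subset x :: p <= W}.
  move=> xp up xS lS v /predU1P[->|vp]; first exact: sSW.
  have [/sSW//|vS] := boolP (v \in S).
  by rewrite !inE (uniq_path_separates acG xp up) ?orbT.
have connp x p y : path (@adj G) x p -> {subset x :: p <= W} ->
    y \in x :: p -> connect (edge_rel (induced_edges W)) x y.
  elim: p x => [|c p IHp] x /=.
    by move=> _ _; rewrite inE => /eqP->; apply: connect0.
  case/andP=> xc cp sub /predU1P[->|]; first exact: connect0.
  move/(IHp c cp) => cy.
  have xW : x \in W by apply: sub; rewrite mem_head.
  have cW : c \in W by apply: sub; rewrite !inE eqxx orbT.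
  apply: (@connect_trans _ _ c); last first.
    by apply: cy => z zp; apply: sub; rewrite inE zp orbT.
  by apply: connect1; rewrite edge_rel_induced xc xW.
have [s sS] := set0Pn _ S0.
(* It is enough to join every vertex of the hull to the fixed element [s] of
   [S]. *)
apply: connected_subgraph_induced; first by apply/set0Pn; exists s; apply: sSW.
suff conn z : z \in W -> connect (edge_rel (induced_edges W)) s z.
  move=> x y /conn sx /conn; apply: connect_trans.
  by rewrite connect_edge_rel_sym.
case/setUP => [zS|].
  have [p [sp lst up]] := upath s z.
  apply: (connp _ p) => //; first by apply: hullp; rewrite // lst.
  by rewrite -lst mem_last.
rewrite inE => sepz.
case/andP: (sepz) => zS /existsP[a /existsP[b /and3P[aS bS nab]]].
(* As [z] separates [a] from [b], the path from [a] to [b] goes through [z]. *)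
have [p [ap lst up]] := upath (val a) (val b).
have zp : z \in val a :: p.
  apply: contraNT nab; rewrite inE negb_or => /andP[_ zp].
  exact: path_del_connect ap zp lst.
have [q [sq lstq uq]] := upath s (val a).
apply: (@connect_trans _ _ (val a)).
  by apply: (connp _ q) => //; [apply: hullp; rewrite // lstq | rewrite -lstq mem_last].
by apply: (connp _ p) => //; apply: hullp; rewrite // lst.
Qed.

Lemma steiner_diversityE S :
  is_tree G -> S != set0 -> (steiner_diversity S).+1 = #|steiner_hull S|.
Proof.
move=> tG S0.
have lower W E : connected_subgraph (W, E) -> S \subset W ->
    #|steiner_hull S| <= #|E|.+1.
  move=> cWE sSW; apply: leq_trans (leq_card_edges cWE).
  apply/subset_leq_card/subsetP=> v /setUP[/(subsetP sSW)//|].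
  by rewrite inE; apply: separates_mem_connected_subgraph cWE sSW.
have [F [_ cF cardF]] := spanning_tree (connected_steiner_hull tG S0).
apply/eqP; rewrite eqn_leq -cardF !ltnS; apply/andP; split.
  by apply: (@bigminn_leq _ _ _ _ (steiner_hull S, F)); rewrite cF subsetUl.
rewrite /steiner_diversity.
elim/big_ind: _ => [|m n mS nS|[W E] /andP[cWE sSW]].
- by rewrite -ltnS cardF; apply: lower (subsetT S); apply/connected_subgraph_total/tG.1.
- by rewrite leq_min mS.
- by rewrite -ltnS cardF; apply: lower cWE sSW.
Qed.

End Steiner.
(** * Counting subsets by their traces on the blocks of a partition *)

Section Profiles.
Variables (I T : finType) (B : I -> {set T}).
Hypothesis B_cover : forall x, exists i, x \in B i.
Hypothesis B_disjoint : forall i j x, x \in B i -> x \in B j -> i = j.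

Lemma sum_card_blocks (A : {set T}) : \sum_i #|A :&: B i| = #|A|.
Proof.
rewrite -[RHS]sum1_card.
under eq_bigr => i _ do rewrite -sum1_card big_mkcond /=.
rewrite exchange_big [RHS]big_mkcond; apply: eq_bigr => x _ /=.
have [i xi] := B_cover x.
rewrite (bigD1 i) //= inE xi andbT big1 ?addn0 // => j /eqP ji.
by rewrite inE; case: ifP => // /andP[_ /(B_disjoint xi)/esym].
Qed.

(** A set amounts to the family of its traces on the blocks, which can be chosen
independently. *)
Lemma card_block_profile (m : I -> nat) :
  #|[set A : {set T} | [forall i, #|A :&: B i| == m i]]|
  = \prod_i 'C(#|B i|, m i).
Proof.
under eq_bigr => i _ do rewrite -cards_draws -sum1_card.
rewrite bigA_distr_big_dep; under [RHS]eq_bigr => f _ do rewrite big1_eq.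
rewrite sum1_card.
pose parts (A : {set T}) := [ffun i => A :&: B i].
have parts_inj : injective parts.
  move=> A A' /ffunP e; apply/setP=> x; have [i xi] := B_cover x.
  by move: (e i); rewrite !ffunE => /setP/(_ x); rewrite !inE xi !andbT.
rewrite -(card_imset _ parts_inj); apply: eq_card => f.
apply/imsetP/familyP => [[A] | fF].
  rewrite inE => /forallP mA -> i; rewrite unfold_in /= ffunE.
  by rewrite !inE subsetIr mA.
have fB i : f i \subset B i by have := fF i; rewrite !inE => /andP[].
have eB i : (\bigcup_j f j) :&: B i = f i.
  apply/setP=> x; apply/setIP/idP => [[/bigcupP[j _ xj] xi]|xi].
    by rewrite (B_disjoint xi (subsetP (fB j) _ xj)).
  split; last exact: (subsetP (fB i)).
  by apply/bigcupP; exists i.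
exists (\bigcup_i f i).
  rewrite inE; apply/forallP => i; rewrite eB.
  by have := fF i; rewrite !inE => /andP[].
by apply/ffunP=> i; rewrite ffunE eB.
Qed.

(** The bound [l i < k] in the sum excludes exactly the sets that have [k]
elements in a single block. *)
Lemma sum_block_profiles k : 0 < k ->
  \sum_(l : {ffun I -> 'I_k} | \sum_i l i == k) \prod_i 'C(#|B i|, l i)
  = #|[set A : {set T} | (#|A| == k) && [forall i, #|A :&: B i| < k]]|.
Proof.
case: k => // k _; rewrite -[RHS]sum1_card.
pose profile (A : {set T}) : {ffun I -> 'I_k.+1} :=
  [ffun i => inord #|A :&: B i|].
have profileE A i : #|A :&: B i| < k.+1 -> profile A i = #|A :&: B i| :> nat.
  by move=> lt; rewrite ffunE inordK.
rewrite (partition_big profile (fun l => \sum_i l i == k.+1)) /=; last first.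
  move=> A; rewrite inE => /andP[/eqP cardA /forallP lt].
  apply/eqP; rewrite -[RHS]cardA -(sum_card_blocks A).
  by apply: eq_bigr => i _; apply: profileE.
apply: eq_bigr => l /eqP suml; rewrite -card_block_profile -sum1_card.
apply: eq_bigl => A; rewrite !inE.
apply/forallP/andP => [eA|[/andP[_ /forallP lt] /eqP<-] i].
  have lt i : #|A :&: B i| < k.+1 by rewrite (eqP (eA i)).
  split; last by apply/eqP/ffunP => i; apply/val_inj; rewrite /= profileE // (eqP (eA i)).
  apply/andP; split; last exact/forallP.
  by rewrite -sum_card_blocks -suml; apply/eqP/eq_bigr => i _; apply/eqP.
by rewrite profileE.
Qed.

End Profiles.

(** * Counting the separated sets *)

Lemma mem_components (F : sgraph) (C : {set F}) x y :
  C \in components F -> x \in C -> (y \in C) = connect (@adj F) x y.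
Proof.
case/imsetP=> z _ ->; rewrite !inE /= => zx.
exact: (same_connect (@connect_adj_sym F) zx).
Qed.

(** [Nk k F] is the number of [k]-sets of vertices not contained in one
component of [F]. *)
Lemma NkE (F : sgraph) k : 0 < k ->
  Nk k F =
  #|[set A : {set F} | (#|A| == k) &&
     [exists x, exists y, [&& x \in A, y \in A & ~~ connect (@adj F) x y]]]|.
Proof.
move=> k0; rewrite /Nk.
have coverF x : exists i : 'I_#|components F|, x \in enum_val i.
  have Cx : [set y in [set: F] | connect (@adj F) x y] \in components F.
    by apply: imset_f; rewrite inE.
  exists (enum_rank_in Cx [set y in [set: F] | connect (@adj F) x y]).
  by rewrite enum_rankK_in // !inE connect0.
have compE (i : 'I_#|components F|) x y :
    x \in enum_val i -> (y \in enum_val i) = connect (@adj F) x y.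
  exact/mem_components/enum_valP.
case: ifP => [_|/negbT p1].
  rewrite sum_block_profiles //; last first.
    move=> i j x xi xj; apply/enum_val_inj/setP => y.
    by rewrite (compE i x) // (compE j x).
  apply: eq_card => A; rewrite !inE; case: eqP => //= cardA.
  apply/forallP/existsP => [lt|[x /existsP[y /and3P[xA yA nxy]]] i].
    have [x xA] : exists x, x \in A by apply/set0Pn; rewrite -card_gt0 cardA.
    have [i xi] := coverF x; exists x; apply/existsP.
    have /subsetPn[y yA yi] : ~~ (A \subset enum_val i).
      by apply: contraL (lt i) => /setIidPl->; rewrite cardA ltnn.
    by exists y; rewrite xA yA -(compE i).
  rewrite -cardA; apply/proper_card/properP; split; first exact: subsetIl.
  have [xi|xi] := boolP (x \in enum_val i).
    by exists y; rewrite // inE yA (compE i x).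
  by exists x; rewrite // inE xA.
(* With at most one component, any two vertices are connected. *)
symmetry; apply: eq_card0 => A; rewrite !inE; apply/negbTE.
rewrite negb_and orbC; apply/orP; left.
apply/existsPn => x; apply/existsPn => y; rewrite !negb_and negbK.
have [i xi] := coverF x; have [j yj] := coverF y.
suff ij : i = j by rewrite -(compE i) // ij yj !orbT.
by apply/val_inj => /=; case: (i) (j) => [a la] [b lb] /=; lia.
Qed.

Lemma Nk_del_vertex (G : sgraph) (v : G) k : 0 < k ->
  Nk k (del_vertex v) = \sum_(S : {set G} | #|S| == k) separates v S.
Proof.
move=> k0; rewrite NkE //.
pose im (A : {set del_vertex v}) : {set G} := val @: A.
have im_inj : injective im by apply/imset_inj/val_inj.
have imE A a : (val a \in im A) = (a \in A) by apply/mem_imset/val_inj.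
have imv A : v \notin im A by apply/imsetP => -[[x xv] _ /= e]; rewrite e eqxx in xv.
have im_sep A : separates v (im A) = [exists x, exists y,
     [&& x \in A, y \in A & ~~ connect (@adj (del_vertex v)) x y]].
  rewrite /separates imv; apply: eq_existsb => x; apply: eq_existsb => y.
  by rewrite !imE.
rewrite -(card_imset _ im_inj) -sum1_card big_mkcond [RHS]big_mkcond.
apply: eq_bigr => S _.
suff -> : (S \in [set im A | A in [set A : {set del_vertex v} | (#|A| == k) &&
     [exists x, exists y, [&& x \in A, y \in A
        & ~~ connect (@adj (del_vertex v)) x y]]]])
  = (#|S| == k) && separates v S by case: eqP; case: separates.
apply/imsetP/andP => [[A]|[cardS sepS]].
  rewrite inE => /andP[cardA sepA] ->.
  by rewrite card_imset ?cardA ?im_sep ?sepA //; apply: val_inj.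
have eS : im (val @^-1: S) = S.
  apply/setP=> x; apply/imsetP/idP => [[a aS ->]|xS]; first by rewrite inE in aS.
  have xv : x != v by apply: contraTneq xS => ->; case/andP: sepS.
  by exists (exist _ x xv) => //; rewrite inE.
exists (val @^-1: S); rewrite ?eS // inE -im_sep eS sepS andbT.
by rewrite -(card_imset _ val_inj) -/(im _) eS.
Qed.

Theorem theorem2 (T : sgraph) (n k : nat) (hT : is_tree T) (hn : #|T| = n)
    (hk : 2 <= k) :
  steiner_wiener k T
  = \sum_(v : T) Nk k (del_vertex v) + (k - 1) * 'C(n, k).
Proof.
have k0 : 0 < k by apply: ltnW.
(* Compare both sides set by set, counting the vertices that separate [S]. *)
under eq_bigr => v _ do rewrite Nk_del_vertex //.
rewrite exchange_big /= -hn -card_draws mulnC -sum_nat_const.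
rewrite [X in _ + X](eq_bigl (fun S : {set T} => #|S| == k)); last first.
  by move=> S; rewrite inE.
rewrite -big_split; apply: eq_bigr => S /eqP cardS /=.
apply: succn_inj; rewrite steiner_diversityE //; last by rewrite -card_gt0 cardS.
by rewrite card_steiner_hull cardS; lia.
Qed.
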